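(* Suppose the data $(\dot X_\delta,X_\delta,U_\delta)$, sampled from the system $\dot x(t)=A_sx(t)+B_su(t)+w(t)$, correspond to the noise model $\Delta_{\mathrm{disc}}$, i.e. $\dot X_\delta=A_sX_\delta+B_sU_\delta+W_\delta$ with $W_\delta\in\Delta_{\mathrm{disc}}$. Then the data $(\dot X_\delta,X_\delta,U_\delta)$ are informative for continuous-time quadratic stabilization if and only if there exist $K\in\mathbb{R}^{m\times n}$, $P\in\mathbb{R}^{n\times n}$ and $\beta>0$ such that $P>0$ and $$\begin{bmatrix} -Q-\beta I_n & -P & -PK^\top\\ -P&0&0\\ -KP&0&0\end{bmatrix}+\delta\begin{bmatrix}\dot X_\delta\\-X_\delta\\-U_\delta\end{bmatrix}\begin{bmatrix}\dot X_\delta\\-X_\delta\\-U_\delta\end{bmatrix}^\top\geq 0 .$$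
   Context: Matrix inequalities are in the semidefinite (Loewner) order on symmetric matrices; $P>0$ includes symmetry of $P$. Fix $T>0$, a stepsize $\delta>0$ with $T/\delta\in\mathbb{Z}_{>0}$, a symmetric $Q\in\mathbb{R}^{n\times n}$ with $Q\geq0$, and (unknown) true system matrices $A_s\in\mathbb{R}^{n\times n}$, $B_s\in\mathbb{R}^{n\times m}$. For signals $x:[0,T]\to\mathbb{R}^n$ (state), $\dot x:[0,T]\to\mathbb{R}^n$ (its derivative), $u:[0,T]\to\mathbb{R}^m$ (input), $w:[0,T]\to\mathbb{R}^n$ (noise), the sample matrices are $\dot X_\delta=[\dot x(0)\ \dot x(\delta)\cdots \dot x(T-\delta)]$, $X_\delta=[x(0)\ x(\delta)\cdots x(T-\delta)]$, $U_\delta=[u(0)\ u(\delta)\cdots u(T-\delta)]$, $W_\delta=[w(0)\ w(\delta)\cdots w(T-\delta)]$, each with $T/\delta$ columns. Noise model: $\Delta_{\mathrm{disc}}$ is the set of matrices $W\in\mathbb{R}^{n\times (T/\delta)}$ with $\delta WW^\top\leq Q$. Consistent systems: $\Sigma^\delta=\{(A,B)\in\mathbb{R}^{n\times n}\times\mathbb{R}^{n\times m}\mid \dot X_\delta-AX_\delta-BU_\delta\in\Delta_{\mathrm{disc}}\}$. The sampled data $(\dot X_\delta,X_\delta,U_\delta)$ are informative for continuous-time quadratic stabilization if there exist $K\in\mathbb{R}^{m\times n}$ and $P\in\mathbb{R}^{n\times n}$ such that for all $(A,B)\in\Sigma^\delta$: $P>0$ and $(A+BK)P+P(A+BK)^\top<0$;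 here $P>0$ is required regardless of $\Sigma^\delta$. *)

(* Defs.v *)
From HB Require Import structures.
From mathcomp Require Import all_boot all_order all_algebra.
From mathcomp Require Import all_classical all_reals all_analysis.

Set Implicit Arguments.
Unset Strict Implicit.
Unset Printing Implicit Defensive.

Import Order.TTheory GRing.Theory Num.Theory.
Import numFieldNormedType.Exports.

Local Open Scope classical_set_scope.
Local Open Scope ring_scope.

(* Symmetry is part of (semi)definiteness, so the Loewner order below relates
   two matrices only if their difference is symmetric. *)
Definition possemidef (R : realType) (n : nat) (A : 'M[R]_n) : Prop :=
  A^T = A /\ forall v : 'cV[R]_n, 0 <= (v^T *m A *m v) 0 0.

Definition posdef (R : realType) (n : nat) (A : 'M[R]_n) : Prop :=
  A^T = A /\ forall v : 'cV[R]_n, v != 0 -> 0 < (v^T *m A *m v) 0 0.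

Definition loewner_le (R : realType) (n : nat) (A B : 'M[R]_n) : Prop :=
  possemidef (B - A).

Definition loewner_lt (R : realType) (n : nat) (A B : 'M[R]_n) : Prop :=
  posdef (B - A).

(* A signal on [0, T] is a total function of which only the values on [0, T]
   matter; the limit of difference quotients is taken inside [0, T], so the
   derivative is one-sided at the two end points. *)
Definition derivative_on (R : realType) (n : nat) (T : R)
    (x dx : R -> 'cV[R]_n) : Prop :=
  forall t : R, 0 <= t <= T ->
    (fun s => (s - t)^-1 *: (x s - x t)) @ within `[0, T] t^' --> dx t.

Definition solves_system (R : realType) (n m : nat) (T : R)
    (A : 'M[R]_n) (B : 'M[R]_(n, m))
    (x dx : R -> 'cV[R]_n) (u : R -> 'cV[R]_m) (w : R -> 'cV[R]_n) : Prop :=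
  derivative_on T x dx /\
  forall t : R, 0 <= t <= T -> dx t = A *m x t + B *m u t + w t.

(* [s(0) s(delta) ... s((N - 1) delta)] *)
Definition sample_mx (R : realType) (p N : nat) (delta : R)
    (s : R -> 'cV[R]_p) : 'M[R]_(p, N) :=
  \matrix_(i < p, k < N) s (k%:R * delta) i 0.

Definition Delta_disc (R : realType) (n N : nat) (delta : R) (Q : 'M[R]_n) :
    set 'M[R]_(n, N) :=
  [set W | loewner_le (delta *: (W *m W^T)) Q].

Definition Sigma_delta (R : realType) (n m N : nat) (delta : R) (Q : 'M[R]_n)
    (Xdot X : 'M[R]_(n, N)) (U : 'M[R]_(m, N)) :
    set ('M[R]_n * 'M[R]_(n, m)) :=
  [set AB | Delta_disc delta Q (Xdot - AB.1 *m X - AB.2 *m U)].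

(* P > 0 is required even if no system is consistent with the data. *)
Definition informative_quad_stab (R : realType) (n m N : nat) (delta : R)
    (Q : 'M[R]_n) (Xdot X : 'M[R]_(n, N)) (U : 'M[R]_(m, N)) : Prop :=
  exists (K : 'M[R]_(m, n)) (P : 'M[R]_n),
    loewner_lt 0 P /\
    forall (A : 'M[R]_n) (B : 'M[R]_(n, m)),
      Sigma_delta delta Q Xdot X U (A, B) ->
      loewner_lt ((A + B *m K) *m P + P *m (A + B *m K)^T) 0.

(* Block rows and columns have sizes n, n, m. *)
Definition lmi_const (R : realType) (n m : nat) (Q P : 'M[R]_n)
    (K : 'M[R]_(m, n)) (beta : R) : 'M[R]_(n + (n + m)) :=
  block_mx (- Q - beta%:M) (row_mx (- P) (- (P *m K^T)))
           (col_mx (- P) (- (K *m P))) (block_mx 0 0 0 0).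

Definition lmi_data (R : realType) (n m N : nat)
    (Xdot X : 'M[R]_(n, N)) (U : 'M[R]_(m, N)) : 'M[R]_(n + (n + m), N) :=
  col_mx Xdot (col_mx (- X) (- U)).

(* Main.v *)
Require Import Defs.
From HB Require Import structures.
From mathcomp Require Import all_boot all_order all_algebra.
From mathcomp Require Import all_classical all_reals all_analysis.
From mathcomp Require Import ring lra.
Import Order.TTheory GRing.Theory Num.Theory.
Import numFieldNormedType.Exports.
Local Open Scope ring_scope.

(** Write Y for the derivative samples, S for the stacked state and input
    samples, Z = [A B] and F = [P; K P], so that (A + B K) P = Z F; a prime is a
    transpose.  At the block vector (v, z), the matrix inequality reads

      beta |v|^2 + (v'Qv - delta |Y'v - S'z|^2) <= - 2 z'Fv       ([lmi_leP]).

    If Z is consistent with the data, the choice z = Z'v makes the bracket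
    nonnegative, which gives v'(ZF)v < 0 for v <> 0; this is sufficiency.

    Necessity is an S-procedure for a family of matrices Z.  The consistent set
    contains [As Bs] and is unbounded along the E with E S = 0; a strict
    inequality affine in Z can hold along all these lines only if E F vanishes
    for them, that is F = S G ([stabilized_factor]).  Hence only ZS matters, and
    it ranges over the matrices whose rows lie in the row space of S.  Let Pi be
    the orthogonal projector on that space ([row_projector]).  The Pythagorean
    theorem ([residual_pythagoras]) rewrites consistency of Z as
    delta |w|^2 <= v'Dv for all v, where w = Pi Y'v - S'Z'v and
    D = Q - delta Y(1 - Pi)Y' is positive semidefinite because the true system
    is consistent.  Conversely, for a fixed v <> 0 and any w with
    delta |w|^2 <= v'Dv, an explicit rank-one perturbation produces a
    consistent Z with S'Z'v = Pi Y'v - Pi w.  Stabilization of all consistent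
    systems thus becomes an implication between two quadratic forms in (v, w):

      (v, w) <> 0 and v'Dv - delta |w|^2 >= 0  imply  w'Gv - v'YGv > 0.

    The strict S-lemma ([strict_S_lemma]) supplies a multiplier alpha >= 0 and a
    margin beta > 0 for it.  The form on the right is zero on the vectors
    (0, w), which forces alpha > 0; substituting w = Pi Y'v - S'z and replacing
    P by P / (2 alpha) yields the inequality displayed above. *)

(** * The Euclidean inner product on column vectors *)

Definition dot {R : realType} {k : nat} (u v : 'cV[R]_k) : R :=
  (u^T *m v) 0 0.

Lemma dotE {R : realType} {k : nat} (u v : 'cV[R]_k) :
  dot u v = \sum_i u i 0 * v i 0.
Proof. by rewrite /dot mxE; apply: eq_bigr => i _; rewrite mxE. Qed.

Lemma dotC {R : realType} {k : nat} (u v : 'cV[R]_k) : dot u v = dot v u.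
Proof. by rewrite !dotE; apply: eq_bigr => i _; rewrite mulrC. Qed.

Lemma dotDr {R : realType} {k : nat} (u v w : 'cV[R]_k) :
  dot u (v + w) = dot u v + dot u w.
Proof. by rewrite /dot mulmxDr mxE. Qed.

Lemma dotDl {R : realType} {k : nat} (u v w : 'cV[R]_k) :
  dot (u + v) w = dot u w + dot v w.
Proof. by rewrite dotC dotDr !(dotC w). Qed.

Lemma dotZr {R : realType} {k : nat} (a : R) (u v : 'cV[R]_k) :
  dot u (a *: v) = a * dot u v.
Proof. by rewrite /dot -scalemxAr mxE. Qed.

Lemma dotZl {R : realType} {k : nat} (a : R) (u v : 'cV[R]_k) :
  dot (a *: u) v = a * dot u v.
Proof. by rewrite dotC dotZr dotC. Qed.

Lemma dotNr {R : realType} {k : nat} (u v : 'cV[R]_k) :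
  dot u (- v) = - dot u v.
Proof. by rewrite -scaleN1r dotZr mulN1r. Qed.

Lemma dotNl {R : realType} {k : nat} (u v : 'cV[R]_k) :
  dot (- u) v = - dot u v.
Proof. by rewrite dotC dotNr dotC. Qed.

Lemma dot0r {R : realType} {k : nat} (u : 'cV[R]_k) : dot u 0 = 0.
Proof. by rewrite -(scale0r 0) dotZr mul0r. Qed.

Lemma dot_mulmxl {R : realType} {k l : nat} (M : 'M[R]_(l, k))
    (u : 'cV[R]_k) (v : 'cV[R]_l) :
  dot (M *m u) v = dot u (M^T *m v).
Proof. by rewrite /dot trmx_mul mulmxA. Qed.

Lemma dot_mulmxr {R : realType} {k l : nat} (M : 'M[R]_(l, k))
    (u : 'cV[R]_k) (v : 'cV[R]_l) :
  dot v (M *m u) = dot (M^T *m v) u.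
Proof. by rewrite dotC dot_mulmxl dotC. Qed.

Lemma dot_col_mx {R : realType} {k l : nat} (u u' : 'cV[R]_k)
    (v v' : 'cV[R]_l) :
  dot (col_mx u v) (col_mx u' v') = dot u u' + dot v v'.
Proof. by rewrite /dot tr_col_mx mul_row_col mxE. Qed.

Lemma dot_ge0 {R : realType} {k : nat} (u : 'cV[R]_k) : 0 <= dot u u.
Proof. by rewrite dotE sumr_ge0// => i _; rewrite -expr2 sqr_ge0. Qed.

Lemma dot_eq0 {R : realType} {k : nat} (u : 'cV[R]_k) :
  (dot u u == 0) = (u == 0).
Proof.
apply/idP/eqP => [|->]; last by rewrite dot0r.
rewrite dotE psumr_eq0 => [/allP u0|i _]; last by rewrite -expr2 sqr_ge0.
apply/matrixP => i j; rewrite mxE ord1.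
by have := u0 i (mem_index_enum _); rewrite -expr2 sqrf_eq0 => /eqP.
Qed.

Lemma dot_gt0 {R : realType} {k : nat} (u : 'cV[R]_k) :
  (0 < dot u u) = (u != 0).
Proof. by rewrite lt_def dot_eq0 dot_ge0 andbT. Qed.

(** * The strict S-lemma *)

Lemma continuous_quad {R : realType} {k : nat} (A : 'M[R]_k) :
  continuous (fun y : 'rV[R]_k => dot y^T (A *m y^T)).
Proof.
have -> : (fun y : 'rV[R]_k => dot y^T (A *m y^T)) =
    fun y => \sum_i y 0 i * \sum_j A i j * y 0 j.
  apply/funext => y; rewrite dotE; apply: eq_bigr => i _; rewrite !mxE.
  by congr (_ * _); apply: eq_bigr => j _; rewrite mxE.
apply: (continuous_big add_continuous) => i _ y.
apply: continuousM; first exact: coord_continuous.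
apply: (continuous_big add_continuous) => j _ z.
by apply: continuousM; [exact: cst_continuous|exact: coord_continuous].
Qed.

(** The cone meets the Euclidean unit sphere in a compact set, so the form of A
    attains its minimum there; homogeneity extends the bound to the cone.  The
    minimizer c has unit length, which is why no factor |c|^2 appears. *)
Lemma quad_min_on_cone {R : realType} {k : nat} (A B : 'M[R]_k)
    (u0 : 'cV[R]_k) :
  u0 != 0 -> 0 <= dot u0 (B *m u0) ->
  exists2 c : 'cV[R]_k, c != 0 /\ 0 <= dot c (B *m c) &
    forall v : 'cV[R]_k, 0 <= dot v (B *m v) ->
      dot c (A *m c) * dot v v <= dot v (A *m v).
Proof.
move=> u0_neq0 Bu0.
pose S := [set y : 'rV[R]_k | dot y^T (1%:M *m y^T) = 1 /\
                             0 <= dot y^T (B *m y^T)]%classic.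
pose unit_of (v : 'cV[R]_k) := (Num.sqrt (dot v v))^-1 *: v^T.
have quad_unit M (v : 'cV[R]_k) : v != 0 ->
    dot (unit_of v)^T (M *m (unit_of v)^T) = (dot v v)^-1 * dot v (M *m v).
  move=> v0; rewrite /unit_of linearZ /= trmxK -scalemxAr dotZl dotZr mulrA.
  by rewrite -expr2 exprVn sqr_sqrtr ?dot_ge0.
have S_unit (v : 'cV[R]_k) : v != 0 -> 0 <= dot v (B *m v) -> S (unit_of v).
  move=> v0 Bv; split; rewrite quad_unit//.
    by rewrite mul1mx mulVf// dot_eq0.
  by rewrite mulr_ge0// invr_ge0 dot_ge0.
have Scompact : compact S.
  apply: bounded_closed_compact.
    exists 1; split; first exact: real1.
    move=> M M1 y [y1 _]; rewrite /Num.norm /= mx_normrE.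
    apply: bigmax_le => [|[i j] _ /=]; first exact: le_trans (ltW M1).
    apply: le_trans (ltW M1); rewrite -(@ler_pXn2r _ 2)// ?nnegrE// expr1n.
    rewrite -normrX ger0_norm ?sqr_ge0// -y1 mul1mx dotE (bigD1 j)//= !mxE.
    by rewrite ord1 -expr2 lerDl sumr_ge0// => l _; rewrite -expr2 sqr_ge0.
  apply: closedI.
    apply: (@preimage_closed _ _ (fun y : 'rV[R]_k => dot y^T (1%:M *m y^T))
      [set r | r = 1]%classic); last exact: closed_eq.
    by move=> y _; exact: continuous_quad.
  apply: (@preimage_closed _ _ (fun y : 'rV[R]_k => dot y^T (B *m y^T))
    [set r | 0 <= r]%classic); last exact: closed_ge.
  by move=> y _; exact: continuous_quad.
have Scont :
    {within S, continuous (fun y : 'rV[R]_k => dot y^T (A *m y^T))}%classic.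
  exact/continuous_subspaceT/continuous_quad.
have S0 : (S !=set0)%classic by exists (unit_of u0); exact: S_unit.
have [y] := compact_EVT_min S0 Scompact Scont.
rewrite inE => -[y1 By] ymin.
exists y^T; first split=> //.
  by rewrite -dot_eq0 -[X in dot _ X]mul1mx y1 oner_eq0.
move=> v Bv; have [->|v0] := eqVneq v 0; first by rewrite mulmx0 !dot0r mulr0.
have := ymin (unit_of v); rewrite inE quad_unit// => /(_ (S_unit _ v0 Bv)).
by rewrite mulrC ler_pdivlMr ?dot_gt0.
Qed.

Lemma quad_pencil {R : realType} {k : nat} (A : 'M[R]_k) (u v : 'cV[R]_k)
    (t : R) :
  dot (u + t *: v) (A *m (u + t *: v)) =
    dot u (A *m u) + t * (dot u (A *m v) + dot v (A *m u)) +
    t ^+ 2 * dot v (A *m v).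
Proof.
by rewrite mulmxDr -scalemxAr !dotDl !dotDr !dotZl !dotZr; ring.
Qed.

Lemma indefinite_roots {R : realType} (p s r : R) : 0 < p -> r < 0 ->
  (exists2 t, 0 <= t & p + t * s + t ^+ 2 * r = 0) /\
  (exists2 t, t <= 0 & p + t * s + t ^+ 2 * r = 0).
Proof.
move=> p0 r0; pose D := Num.sqrt (s ^+ 2 - 4 * p * r).
have D2 : D ^+ 2 = s ^+ 2 - 4 * p * r by rewrite sqr_sqrtr//; nra.
have D0 : 0 <= D := sqrtr_ge0 _.
have /andP[sD Ds] : - D <= s <= D.
  rewrite -ler_norml -(@ler_pXn2r _ 2)// ?nnegrE// -normrX.
  by rewrite ger0_norm ?sqr_ge0// D2; nra.
have r_neq0 : r != 0 by rewrite lt_eqF.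
have r2 : (- 2 * r)^-1 >= 0 by rewrite invr_ge0; lra.
split; [exists ((s + D) / (- 2 * r))|exists ((s - D) / (- 2 * r))].
- by rewrite mulr_ge0//; lra.
- have -> : p + (s + D) / (- 2 * r) * s + ((s + D) / (- 2 * r)) ^+ 2 * r =
    (D ^+ 2 - (s ^+ 2 - 4 * p * r)) / (4 * r) by field.
  by rewrite D2 subrr mul0r.
- by rewrite mulr_le0_ge0//; lra.
- have -> : p + (s - D) / (- 2 * r) * s + ((s - D) / (- 2 * r)) ^+ 2 * r =
    (D ^+ 2 - (s ^+ 2 - 4 * p * r)) / (4 * r) by field.
  by rewrite D2 subrr mul0r.
Qed.

(** The S-lemma inside the plane spanned by u and v.  On the line u + t v the
    form of B has one root on each side of 0.  At both roots the form
    B(u) A - A(u) B is positive; it vanishes at t = 0, so it cannot have a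
    nonpositive coefficient of t^2, and the sign of that coefficient is the
    claim. *)
Lemma ratio_separation {R : realType} {k : nat} (A B : 'M[R]_k)
    (u v : 'cV[R]_k) :
  (forall z, z != 0 -> 0 <= dot z (B *m z) -> 0 < dot z (A *m z)) ->
  0 < dot u (B *m u) -> dot v (B *m v) < 0 ->
  dot u (A *m u) * dot v (B *m v) < dot v (A *m v) * dot u (B *m u).
Proof.
move=> BA Bu Bv.
set a := dot u (A *m u); set b := dot u (B *m u).
set a' := dot v (A *m v); set b' := dot v (B *m v).
set ca := dot u (A *m v) + dot v (A *m u).
set cb := dot u (B *m v) + dot v (B *m u).
have root_pos t : b + t * cb + t ^+ 2 * b' = 0 ->
    0 < t * (b * ca - a * cb) + t ^+ 2 * (b * a' - a * b').
  move=> Bt; have : 0 < dot (u + t *: v) (A *m (u + t *: v)).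
    apply: BA; last by rewrite quad_pencil Bt.
    apply/eqP => /addr0_eq/(congr1 -%R); rewrite opprK => uE.
    have := Bu; rewrite /b uE mulmxN -scalemxAr dotNl dotNr dotZl dotZr opprK.
    rewrite mulrA -expr2 -/b' ltNge mulr_ge0_le0 ?sqr_ge0//.
    exact: ltW.
  rewrite quad_pencil -/a -/a' -/ca => At.
  have := mulr_gt0 Bu At; rewrite -/b.
  have -> : b * (a + t * ca + t ^+ 2 * a') =
    t * (b * ca - a * cb) + t ^+ 2 * (b * a' - a * b') +
    a * (b + t * cb + t ^+ 2 * b') by ring.
  by rewrite Bt mulr0 addr0.
rewrite ltNge; apply/negP => le_ab.
have [[t1 t1_ge0 Bt1] [t2 t2_le0 Bt2]] := indefinite_roots _ cb _ Bu Bv.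
have := root_pos _ Bt1; have := root_pos _ Bt2.
have : t1 ^+ 2 * (b * a' - a * b') <= 0.
  by apply: mulr_ge0_le0; [exact: sqr_ge0|lra].
have : t2 ^+ 2 * (b * a' - a * b') <= 0.
  by apply: mulr_ge0_le0; [exact: sqr_ge0|lra].
have [C0|C0] := leP 0 (b * ca - a * cb).
  by have := mulr_le0_ge0 t2_le0 C0; lra.
by have := mulr_ge0_le0 t1_ge0 (ltW C0); lra.
Qed.

Lemma quad_coercive_on_cone {R : realType} {k : nat} (A B : 'M[R]_k) :
  (forall z, z != 0 -> 0 <= dot z (B *m z) -> 0 < dot z (A *m z)) ->
  exists2 c, 0 < c & forall v,
    0 <= dot v (B *m v) -> c * dot v v <= dot v (A *m v).
Proof.
move=> BA.
have [[u [u0 Bu]]|noB] := pselect (exists u, u != 0 /\ 0 <= dot u (B *m u)).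
  have [w [w0 Bw] Aw] := quad_min_on_cone A B u u0 Bu.
  by exists (dot w (A *m w)); first exact: BA.
exists 1; first exact: ltr01.
move=> v Bv; have [->|v0] := eqVneq v 0; first by rewrite mulmx0 !dot0r mulr0.
by case: noB; exists v.
Qed.

(** Every vector lies in the cone of the zero form. *)
Lemma quad_lower_bound {R : realType} {k : nat} (A : 'M[R]_k) :
  exists c, forall v, c * dot v v <= dot v (A *m v).
Proof.
have [[u u0]|nou] := pselect (exists u : 'cV[R]_k, u != 0).
  have [|w _ Aw] := quad_min_on_cone A 0 u u0.
    by rewrite mul0mx dot0r.
  by exists (dot w (A *m w)) => v; rewrite Aw// mul0mx dot0r.
exists 0 => v; have [->|v0] := eqVneq v 0; first by rewrite mulmx0 !dot0r mulr0.
by case: nou; exists v.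
Qed.

(** With A' = A - c/2, where c is the coercivity constant of A on the cone
    B >= 0, it suffices to find alpha >= 0 with A' - alpha B >= 0.  This asks
    that alpha be at least A'(v)/B(v) where B(v) < 0 and at most A'(v)/B(v)
    where B(v) > 0.  The first ratio can only be positive where A'(v) <= 0, and
    there B is negative definite with a margin, so the supremum of the ratios is
    finite; [ratio_separation] puts it below every ratio of the second kind. *)
Theorem strict_S_lemma {R : realType} {k : nat} (A B : 'M[R]_k) :
  (forall z, z != 0 -> 0 <= dot z (B *m z) -> 0 < dot z (A *m z)) ->
  exists alpha beta : R, [/\ 0 <= alpha, 0 < beta &
    forall v, beta * dot v v + alpha * dot v (B *m v) <= dot v (A *m v)].
Proof.
move=> BA.
have [c c0 Ac] := quad_coercive_on_cone A B BA.
pose A' := A - (c / 2)%:M.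
have A'E v : dot v (A' *m v) = dot v (A *m v) - c / 2 * dot v v.
  by rewrite mulmxBl mul_scalar_mx dotDr dotNr dotZr.
have BA' z : z != 0 -> 0 <= dot z (B *m z) -> 0 < dot z (A' *m z).
  move=> z0 /Ac; rewrite A'E; have : 0 < dot z z by rewrite dot_gt0.
  by nra.
have [c' c'0 Bc'] : exists2 c', 0 < c' & forall v,
    dot v (A' *m v) <= 0 -> dot v (B *m v) <= - (c' * dot v v).
  have [z z0|c' c'0 Bc'] := quad_coercive_on_cone (- B) (- A').
    rewrite !mulNmx !dotNr oppr_ge0 oppr_gt0 => A'z.
    by rewrite ltNge; apply/negP => /(BA' _ z0); lra.
  exists c' => // v A'v; have := Bc' v.
  by rewrite !mulNmx !dotNr oppr_ge0 lerNr => /(_ A'v).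
have [M A'M] := quad_lower_bound A'.
(* The element 0 makes the set nonempty and its supremum nonnegative. *)
pose E := [set r | r = 0 \/ exists v, [/\ v != 0, dot v (A' *m v) <= 0 &
  r = dot v (A' *m v) / dot v (B *m v)]]%classic.
have E0 : E 0 by left.
have B_lt0 v : v != 0 -> dot v (A' *m v) <= 0 -> dot v (B *m v) < 0.
  move=> v0 /Bc' Bv; apply: (le_lt_trans Bv); rewrite oppr_lt0.
  by rewrite mulr_gt0// dot_gt0.
have ubE : has_ubound E.
  exists (`|M| / c') => r [->|[v [v0 A'v ->]]].
    by rewrite divr_ge0// ltW.
  rewrite ler_ndivrMr ?B_lt0//.
  rewrite mulrAC ler_pdivrMr//.
  have := A'M v; have := Bc' _ A'v; have := dot_ge0 v.
  have := ler_norm (- M); rewrite normrN; have := normr_ge0 M.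
  set d := dot v v; set x := dot _ _; set y := dot _ _; set m := `|M|.
  move=> m0 Mm d0 yd xd.
  have mx : m * x <= m * - (c' * d) by apply: ler_wpM2l.
  have cy : c' * (M * d) <= c' * y by apply: ler_wpM2l => //; exact: ltW.
  have : 0 <= c' * ((M + m) * d).
    by rewrite !mulr_ge0//; [exact: ltW|lra].
  lra.
exists (sup E), (c / 2); split; first exact: ub_le_sup.
  by rewrite divr_gt0.
move=> v; rewrite -lerBrDl -A'E.
have [->|v0] := eqVneq v 0; first by rewrite !mulmx0 !dot0r mulr0.
have [A'v|A'v] := leP (dot v (A' *m v)) 0.
  rewrite -ler_ndivrMr ?B_lt0//; apply: ub_le_sup => //; right.
  by exists v.
have supE0 : 0 <= sup E by exact: ub_le_sup.
have [Bv|Bv] := leP (dot v (B *m v)) 0.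
  by apply: le_trans (ltW A'v); apply: mulr_ge0_le0.
rewrite -ler_pdivlMr//; apply: ge_sup; first by exists 0.
move=> r [->|[u [u0 A'u ->]]]; first by rewrite divr_ge0 ?ltW.
rewrite ler_pdivlMr// mulrAC ler_ndivrMr ?B_lt0//.
exact/ltW/(ratio_separation A' B v u BA')/B_lt0.
Qed.

(** * Orthogonal projection on a row space *)

Lemma mulmx_cV_eq0 {R : realType} {k l : nat} (M : 'M[R]_(k, l)) :
  (forall v : 'cV[R]_l, M *m v = 0) -> M = 0.
Proof.
move=> M0; apply/matrixP => i j; rewrite mxE.
by have := M0 (delta_mx j 0); rewrite -colE => /matrixP/(_ i 0); rewrite !mxE.
Qed.

Lemma gram_eq0 {R : realType} {k l : nat} (M : 'M[R]_(k, l)) :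
  M^T *m M = 0 -> M = 0.
Proof.
move=> MM; apply: mulmx_cV_eq0 => v; apply/eqP; rewrite -dot_eq0.
by rewrite dot_mulmxl mulmxA MM mul0mx dot0r.
Qed.

(** S' has the same row space as the Gram matrix S S', so the normal equations
    H S S' = S' are solvable, and H S is the orthogonal projector on the row
    space of S.  Keeping the factor H is useful: a matrix V (H S) has the form
    Z S with Z = V H. *)
Lemma row_projector {R : realType} {p N : nat} (S : 'M[R]_(p, N)) :
  exists H : 'M[R]_(N, p), (H *m S)^T = H *m S /\ S *m (H *m S) = S.
Proof.
have /submxP[H HS] : (S^T <= S *m S^T)%MS.
  rewrite submxE; apply/eqP/gram_eq0.
  by rewrite trmx_mul trmxK -!mulmxA (mulmxA S) mulmx_coker mulmx0.
have SPi : S *m (H *m S)^T = S.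
  by apply: trmx_inj; rewrite trmx_mul trmxK -mulmxA -HS.
have PiPiT : H *m S *m (H *m S)^T = H *m S by rewrite -mulmxA SPi.
have PiT : (H *m S)^T = H *m S by rewrite -[in LHS]PiPiT trmx_mul trmxK PiPiT.
by exists H; split=> //; rewrite -[in LHS]PiT.
Qed.

(** * Systems consistent with the data *)

(** For symmetric Q this is delta (Y - ZS)(Y - ZS)' <= Q in the Loewner order
    (a prime is a transpose). *)
Definition consistent {R : realType} {n p N : nat} (delta : R) (Q : 'M[R]_n)
    (Y : 'M[R]_(n, N)) (S : 'M[R]_(p, N)) (Z : 'M[R]_(n, p)) : Prop :=
  forall v : 'cV[R]_n,
    delta * dot ((Y - Z *m S)^T *m v) ((Y - Z *m S)^T *m v) <= dot v (Q *m v).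

(** Let C be a cokernel of S', so that C'S = 0 and F = S G amounts to C'F = 0.
    Suppose that some c = C'Fv is nonzero.  Adding t F'CC' to Z0 does not change
    Z0 S, hence keeps consistency, and changes v'Z0Fv by t |c|^2, which can be
    brought up to 0. *)
Lemma stabilized_factor {R : realType} {n p N : nat} (delta : R) (Q : 'M[R]_n)
    (Y : 'M[R]_(n, N)) (S : 'M[R]_(p, N)) (F : 'M[R]_(p, n))
    (Z0 : 'M[R]_(n, p)) :
  consistent delta Q Y S Z0 ->
  (forall Z, consistent delta Q Y S Z ->
     forall v, v != 0 -> dot v (Z *m F *m v) < 0) ->
  exists G : 'M[R]_(N, n), F = S *m G.
Proof.
move=> Z0cons stab; pose C := cokermx S^T.
have SC : C^T *m S = 0.
  by apply: trmx_inj; rewrite trmx_mul trmxK mulmx_coker trmx0.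
have CF : C^T *m F = 0.
  apply: mulmx_cV_eq0 => v; have [->|v0] := eqVneq v 0; first by rewrite mulmx0.
  set c := C^T *m F *m v.
  apply/eqP; rewrite -dot_eq0; apply/negP => /negP c0.
  pose t := - dot v (Z0 *m F *m v) / dot c c.
  have /stab/(_ v v0) : consistent delta Q Y S (Z0 + t *: (F^T *m C *m C^T)).
    by rewrite /consistent mulmxDl -scalemxAl -!mulmxA SC !mulmx0 scaler0 addr0.
  have -> : (Z0 + t *: (F^T *m C *m C^T)) *m F *m v =
      Z0 *m F *m v + t *: ((C^T *m F)^T *m c).
    rewrite mulmxDl -scalemxAl mulmxDl -scalemxAl (trmx_mul C^T) trmxK /c.
    by rewrite !mulmxA.
  by rewrite dotDr dotZr -dot_mulmxl -/c divfK// subrr ltxx.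
have /submxP[D FD] : (F^T <= S^T)%MS.
  rewrite submxE -/C; apply/eqP/trmx_inj.
  by rewrite trmx_mul trmxK CF trmx0.
by exists D^T; apply: trmx_inj; rewrite FD trmx_mul trmxK.
Qed.

Lemma quad_cauchy_schwarz {R : realType} {n : nat} (Q : 'M[R]_n)
    (x v : 'cV[R]_n) :
  Q^T = Q -> (forall y, 0 <= dot y (Q *m y)) -> 0 < dot v (Q *m v) ->
  dot x (Q *m v) ^+ 2 <= dot x (Q *m x) * dot v (Q *m v).
Proof.
move=> QT Q0 Qv.
have := Q0 (x + (- (dot x (Q *m v) / dot v (Q *m v))) *: v).
rewrite quad_pencil (dotC v (Q *m x)) dot_mulmxl QT.
set a := dot x (Q *m x); set b := dot x (Q *m v); set c := dot v (Q *m v).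
have -> : a + - (b / c) * (b + b) + (- (b / c)) ^+ 2 * c = a - b ^+ 2 / c.
  by field; rewrite gt_eqF.
by rewrite subr_ge0 ler_pdivrMr.
Qed.


(** What remains of the noise budget Q after the part of the data that no
    system can explain, the component of Y orthogonal to the regressors. *)
Definition residual {R : realType} {n N : nat} (delta : R) (Q : 'M[R]_n)
    (Y : 'M[R]_(n, N)) (Pi : 'M[R]_N) : 'M[R]_n :=
  Q - delta *: (Y *m (1%:M - Pi) *m Y^T).

(** Y'v - r splits orthogonally into (1 - Pi) Y'v and Pi Y'v - r. *)
Lemma residual_pythagoras {R : realType} {n N : nat} (delta : R) (Q : 'M[R]_n)
    (Y : 'M[R]_(n, N)) (Pi : 'M[R]_N) (v : 'cV[R]_n) (r : 'cV[R]_N) :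
  Pi^T = Pi -> Pi *m Pi = Pi -> Pi *m r = r ->
  dot v (residual delta Q Y Pi *m v) -
    delta * dot (Pi *m (Y^T *m v) - r) (Pi *m (Y^T *m v) - r) =
  dot v (Q *m v) - delta * dot (Y^T *m v - r) (Y^T *m v - r).
Proof.
move=> PiT PiPi Pir; set y := Y^T *m v.
have -> : dot v (residual delta Q Y Pi *m v) =
    dot v (Q *m v) - delta * (dot y y - dot y (Pi *m y)).
  rewrite /residual mulmxBl -scalemxAl dotDr dotNr dotZr -!mulmxA -/y.
  by rewrite (dot_mulmxr Y) mulmxBl mul1mx dotDr dotNr.
have Piyr : dot (Pi *m y) r = dot y r by rewrite dot_mulmxl PiT Pir.
have PiyPiy : dot (Pi *m y) (Pi *m y) = dot y (Pi *m y).
  by rewrite dot_mulmxl PiT mulmxA PiPi.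
rewrite !dotDl !dotDr !dotNl !dotNr !(dotC r) Piyr PiyPiy.
by ring.
Qed.

(** The necessity part, before the multiplier is absorbed into P.  The
    consistent system Z0 makes the residual positive semidefinite; N > 0 makes
    alpha positive, since a nonzero w exists. *)
Lemma data_S_lemma {R : realType} {n p N : nat} (delta : R) (Q : 'M[R]_n)
    (Y : 'M[R]_(n, N)) (S : 'M[R]_(p, N)) (F : 'M[R]_(p, n))
    (Z0 : 'M[R]_(n, p)) :
  0 < delta -> (0 < N)%N -> Q^T = Q ->
  consistent delta Q Y S Z0 ->
  (forall Z, consistent delta Q Y S Z ->
     forall v, v != 0 -> dot v (Z *m F *m v) < 0) ->
  exists alpha beta : R, [/\ 0 < alpha, 0 < beta &
    forall (v : 'cV[R]_n) (z : 'cV[R]_p),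
      beta * dot v v + alpha * (dot v (Q *m v) -
        delta * dot (Y^T *m v - S^T *m z) (Y^T *m v - S^T *m z))
      <= - dot z (F *m v)].
Proof.
move=> delta0 N0 QT Z0cons stab.
have [H [PiT SPi]] := row_projector S; set Pi := H *m S in PiT SPi.
have PiPi : Pi *m Pi = Pi by rewrite -[in LHS]mulmxA SPi.
have PiS k (M : 'M[R]_(p, k)) : Pi *m (S^T *m M) = S^T *m M.
  by rewrite mulmxA -[in LHS]PiT -trmx_mul SPi.
have [G FG] : exists2 G : 'M[R]_(N, n), F = S *m G & Pi *m G = G.
  have [G FG] := stabilized_factor delta Q Y S F Z0 Z0cons stab.
  by exists (Pi *m G); rewrite mulmxA ?SPi ?PiPi.
move=> PiG; set Q' := residual delta Q Y Pi.
have Q'T : Q'^T = Q'.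
  rewrite /Q' /residual linearB linearZ /= !trmx_mul trmxK linearB /= trmx1.
  by rewrite PiT QT mulmxA.
have consE Z v : dot v (Q' *m v) -
    delta * dot (Pi *m (Y^T *m v) - S^T *m (Z^T *m v))
                (Pi *m (Y^T *m v) - S^T *m (Z^T *m v)) =
    dot v (Q *m v) - delta * dot ((Y - Z *m S)^T *m v) ((Y - Z *m S)^T *m v).
  rewrite residual_pythagoras ?PiS// linearB /= mulmxBl trmx_mul.
  by rewrite -mulmxA.
have Q'0 v : 0 <= dot v (Q' *m v).
  have := consE Z0 v; have := Z0cons v; set r := Pi *m _ - _.
  by have := mulr_ge0 (ltW delta0) (dot_ge0 r); lra.
pose A := block_mx (- (Y *m G)) 0 G 0 : 'M[R]_(n + N).
pose B := block_mx Q' 0 0 (- delta%:M) : 'M[R]_(n + N).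
have AE v w : dot (col_mx v w) (A *m col_mx v w) =
    dot w (G *m v) - dot v (Y *m G *m v).
  rewrite mul_block_col dot_col_mx !mul0mx !addr0 mulNmx dotNr.
  by rewrite addrC.
have BE v w : dot (col_mx v w) (B *m col_mx v w) =
    dot v (Q' *m v) - delta * dot w w.
  rewrite mul_block_col dot_col_mx !mul0mx addr0 add0r mulNmx dotNr.
  by rewrite mul_scalar_mx dotZr.
have BA x : x != 0 -> 0 <= dot x (B *m x) -> 0 < dot x (A *m x).
  rewrite -[x]vsubmxK; set v := usubmx x; set w := dsubmx x.
  rewrite BE AE => vw0 Bvw.
  have v0 : v != 0.
    apply: contraNneq vw0 => v0; move: Bvw; rewrite v0 mulmx0 dot0r sub0r.
    rewrite oppr_ge0 pmulr_rle0// => w0.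
    have /eqP : dot w w == 0 by rewrite eq_le w0 dot_ge0.
    by move/eqP; rewrite dot_eq0 => /eqP ->; rewrite col_mx0.
  set s := dot v (Q' *m v) in Bvw.
  (* A rank-one term along Q' v stays within the budget Q' by the
     Cauchy-Schwarz inequality for the form of Q'.  When s = 0 the inverse is 0,
     which is right: then w = 0. *)
  pose Z := (Y - s^-1 *: (Q' *m v *m w^T)) *m H.
  have Zdata y : Pi *m (Y^T *m y) - S^T *m (Z^T *m y) =
      (s^-1 * dot y (Q' *m v)) *: (Pi *m w).
    have -> : S^T *m (Z^T *m y) = Pi *m ((Y - s^-1 *: (Q' *m v *m w^T))^T *m y).
      by rewrite mulmxA -trmx_mul /Z -(mulmxA _ H) -/Pi trmx_mul PiT mulmxA.
    rewrite linearB linearZ /= mulmxBl mulmxBr subKr -scalemxAl trmx_mul trmxK.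
    rewrite -(mulmxA w) (mx11_scalar ((Q' *m v)^T *m y)) mul_mx_scalar.
    by rewrite scalerA -scalemxAr -/(dot (Q' *m v) y) dotC.
  have Zcons : consistent delta Q Y S Z.
    move=> y; rewrite -subr_ge0 -consE Zdata dotZl dotZr subr_ge0.
    set xi := dot y (Q' *m v).
    have Piw : dot (Pi *m w) (Pi *m w) <= dot w w.
      have := dot_ge0 (w - Pi *m w).
      rewrite dotDl !dotDr !dotNl !dotNr (dotC (Pi *m w) w).
      have -> : dot (Pi *m w) (Pi *m w) = dot w (Pi *m w).
        by rewrite dot_mulmxl PiT mulmxA PiPi.
      by lra.
    have [s0|s_neq0] := eqVneq s 0; first by rewrite s0 invr0 !mul0r mulr0.
    have s_gt0 : 0 < s by rewrite lt_def s_neq0 Q'0.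
    have CS : xi ^+ 2 <= dot y (Q' *m y) * s.
      exact: quad_cauchy_schwarz.
    apply: (@le_trans _ _ ((s^-1 * xi) ^+ 2 * s)).
      have -> : delta * (s^-1 * xi * (s^-1 * xi * dot (Pi *m w) (Pi *m w))) =
        (s^-1 * xi) ^+ 2 * (delta * dot (Pi *m w) (Pi *m w)) by ring.
      apply: ler_wpM2l; first exact: sqr_ge0.
      have := ler_wpM2l (ltW delta0) Piw; lra.
    have -> : (s^-1 * xi) ^+ 2 * s = xi ^+ 2 / s by field.
    by rewrite ler_pdivrMr.
  have := stab Z Zcons v v0.
  have SZv : S^T *m (Z^T *m v) = Pi *m (Y^T *m v) - Pi *m w.
    have := Zdata v; rewrite -/s.
    have [s0|s_neq0] := eqVneq s 0; last first.
      by rewrite mulVf// scale1r => <-; rewrite subKr.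
    have /eqP : dot w w == 0.
      rewrite eq_le dot_ge0 andbT -(pmulr_rle0 _ delta0).
      by move: Bvw; rewrite s0 sub0r oppr_ge0.
    move/eqP; rewrite dot_eq0 => /eqP ->; rewrite !mulmx0 scaler0 subr0.
    by move/eqP; rewrite subr_eq0 => /eqP.
  have -> : dot v (Z *m F *m v) = dot v (Y *m G *m v) - dot w (G *m v).
    rewrite FG -(mulmxA Z) -(mulmxA S) -(mulmxA Y) (dot_mulmxr Z).
    rewrite (dot_mulmxr S) SZv dotDl dotNl.
    by rewrite !(dot_mulmxl Pi) PiT !(mulmxA Pi) PiG (dot_mulmxr Y).
  by rewrite subr_lt0 subr_gt0.
have [alpha [beta [alpha0 beta0 AB]]] := strict_S_lemma A B BA.
exists alpha, beta; split=> //.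
  (* On (0, w) the form of A vanishes and that of B is - delta |w|^2, so
     beta |w|^2 <= alpha delta |w|^2. *)
  have := AB (col_mx 0 (delta_mx (Ordinal N0) 0)); rewrite AE BE dot_col_mx.
  set e := delta_mx _ _.
  have e0 : 0 < dot e e.
    rewrite dot_gt0; apply/eqP => /matrixP/(_ (Ordinal N0) 0)/eqP.
    by rewrite !mxE !eqxx oner_eq0.
  rewrite !mulmx0 !dot0r !subr0 add0r sub0r => ineq.
  rewrite lt_def alpha0 andbT; apply/eqP => alphaE.
  by have := mulr_gt0 beta0 e0; move: ineq; rewrite alphaE mul0r; lra.
move=> v z; rewrite -(residual_pythagoras delta Q Y Pi v (S^T *m z))// ?PiS//.
set w := Pi *m (Y^T *m v) - S^T *m z.
have := AB (col_mx v w); rewrite AE BE dot_col_mx.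
have -> : dot w (G *m v) - dot v (Y *m G *m v) = - dot z (F *m v).
  rewrite /w dotDl dotNl (dot_mulmxl Pi) PiT (mulmxA Pi) PiG.
  rewrite (dot_mulmxl S^T) trmxK (mulmxA S) -FG -mulmxA (dot_mulmxr Y).
  by rewrite addrAC subrr add0r.
by have := mulr_ge0 (ltW beta0) (dot_ge0 w); lra.
Qed.

(** * Loewner inequalities as scalar inequalities *)

Lemma quad_formE {R : realType} {k : nat} (A : 'M[R]_k) (v : 'cV[R]_k) :
  (v^T *m A *m v) 0 0 = dot v (A *m v).
Proof. by rewrite /dot mulmxA. Qed.

Lemma Delta_discP {R : realType} {n N : nat} (delta : R) (Q : 'M[R]_n)
    (W : 'M[R]_(n, N)) :
  Q^T = Q ->
  Delta_disc delta Q W <->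
  forall v, delta * dot (W^T *m v) (W^T *m v) <= dot v (Q *m v).
Proof.
move=> QT.
have quadE v : (v^T *m (Q - delta *: (W *m W^T)) *m v) 0 0 =
    dot v (Q *m v) - delta * dot (W^T *m v) (W^T *m v).
  rewrite quad_formE mulmxBl -scalemxAl dotDr dotNr dotZr -mulmxA.
  by rewrite (dot_mulmxr W).
split=> [[_ QW] v|QW].
  by rewrite -subr_ge0 -quadE.
split; first by rewrite linearB linearZ /= trmx_mul trmxK QT.
by move=> v; rewrite quadE subr_ge0.
Qed.

Lemma Sigma_deltaP {R : realType} {n m N : nat} (delta : R) (Q : 'M[R]_n)
    (Y X : 'M[R]_(n, N)) (U : 'M[R]_(m, N)) (A : 'M[R]_n) (B : 'M[R]_(n, m)) :
  Q^T = Q ->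
  Sigma_delta delta Q Y X U (A, B) <->
  consistent delta Q Y (col_mx X U) (row_mx A B).
Proof.
move=> QT; rewrite /consistent mul_row_col opprD addrA.
exact: Delta_discP.
Qed.

Lemma closed_loopE {R : realType} {n m : nat} (A P : 'M[R]_n)
    (B : 'M[R]_(n, m)) (K : 'M[R]_(m, n)) :
  (A + B *m K) *m P = row_mx A B *m col_mx P (K *m P).
Proof. by rewrite mul_row_col mulmxDl mulmxA. Qed.

Lemma closed_loop_ltP {R : realType} {n m : nat} (A P : 'M[R]_n)
    (B : 'M[R]_(n, m)) (K : 'M[R]_(m, n)) :
  P^T = P ->
  loewner_lt ((A + B *m K) *m P + P *m (A + B *m K)^T) 0 <->
  forall v, v != 0 -> dot v (row_mx A B *m col_mx P (K *m P) *m v) < 0.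
Proof.
move=> PT; rewrite /loewner_lt /posdef sub0r -closed_loopE.
set L := (A + B *m K) *m P.
have -> : P *m (A + B *m K)^T = L^T by rewrite /L trmx_mul PT.
have quadE v : (v^T *m - (L + L^T) *m v) 0 0 = - (2 * dot v (L *m v)).
  rewrite quad_formE mulNmx dotNr mulmxDl dotDr (dot_mulmxr L^T) trmxK.
  by rewrite (dotC (L *m v)) mulr_natl mulr2n.
split=> [[_ Llt] v /Llt|Llt].
  by rewrite quadE; lra.
split; first by rewrite linearN linearD /= trmxK addrC.
by move=> v /Llt; rewrite quadE; lra.
Qed.

Lemma lmi_leP {R : realType} {n m N : nat} (delta beta : R) (Q P : 'M[R]_n)
    (Y X : 'M[R]_(n, N)) (U : 'M[R]_(m, N)) (K : 'M[R]_(m, n)) :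
  let S := col_mx X U in
  Q^T = Q -> P^T = P ->
  loewner_le 0 (lmi_const Q P K beta +
    delta *: (lmi_data Y X U *m (lmi_data Y X U)^T)) <->
  forall (v : 'cV[R]_n) (z : 'cV[R]_(n + m)),
    beta * dot v v + (dot v (Q *m v) -
      delta * dot (Y^T *m v - S^T *m z) (Y^T *m v - S^T *m z))
    <= - (2 * dot z (col_mx P (K *m P) *m v)).
Proof.
move=> S QT PT; set F := col_mx P (K *m P).
have FT : F^T = row_mx P (P *m K^T) by rewrite tr_col_mx trmx_mul PT.
have -> : lmi_data Y X U = col_mx Y (- S) by rewrite /lmi_data opp_col_mx.
have -> : lmi_const Q P K beta = block_mx (- Q - beta%:M) (- F^T) (- F) 0.
  by rewrite /lmi_const block_mx0 FT opp_row_mx opp_col_mx.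
set D := col_mx Y (- S).
rewrite /loewner_le subr0; set M := _ + _.
have quadE v z : dot (col_mx v z) (M *m col_mx v z) =
    - dot v (Q *m v) - beta * dot v v - 2 * dot z (F *m v) +
    delta * dot (Y^T *m v - S^T *m z) (Y^T *m v - S^T *m z).
  rewrite mulmxDl -scalemxAl dotDr dotZr -mulmxA (dot_mulmxr D).
  rewrite {1 2}/D tr_col_mx mul_row_col linearN /= (mulNmx S^T).
  rewrite mul_block_col dot_col_mx mul0mx addr0 mulmxBl mul_scalar_mx !mulNmx.
  rewrite !dotDr !dotNr dotZr (dot_mulmxr F^T) trmxK (dotC (F *m v)).
  by ring.
split=> [[_ M0] v z|M0].
  by have := M0 (col_mx v z); rewrite quad_formE quadE; lra.
split.
  rewrite /M linearD linearZ /= trmx_mul trmxK tr_block_mx trmx0.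
  by rewrite linearB !linearN /= tr_scalar_mx trmxK QT.
move=> x; rewrite quad_formE -[x]vsubmxK quadE.
by have := M0 (usubmx x) (dsubmx x); lra.
Qed.

(** * Informativity and the linear matrix inequality *)

Theorem mainTheorem2 (R : realType) (n m N : nat) (T delta : R)
    (Q : 'M[R]_n) (As : 'M[R]_n) (Bs : 'M[R]_(n, m))
    (x xdot : R -> 'cV[R]_n) (u : R -> 'cV[R]_m) (w : R -> 'cV[R]_n) :
  let Xdot := sample_mx N delta xdot in
  let X := sample_mx N delta x in
  let U := sample_mx N delta u in
  let W := sample_mx N delta w in
  0 < T -> 0 < delta -> (0 < N)%N -> T / delta = N%:R ->
  loewner_le 0 Q ->
  solves_system T As Bs x xdot u w ->
  Xdot = As *m X + Bs *m U + W ->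
  Delta_disc delta Q W ->
  informative_quad_stab delta Q Xdot X U <->
  exists (K : 'M[R]_(m, n)) (P : 'M[R]_n) (beta : R),
    [/\ 0 < beta,
        loewner_lt 0 P &
        loewner_le 0 (lmi_const Q P K beta +
          delta *: (lmi_data Xdot X U *m (lmi_data Xdot X U)^T))].
Proof.
move=> Xdot X U W _ delta_gt0 N_gt0 _ [QT0 _] _ dataE Wdisc.
have QT : Q^T = Q by move: QT0; rewrite subr0.
have As_cons : consistent delta Q Xdot (col_mx X U) (row_mx As Bs).
  apply/(Delta_discP _ _ _ QT).
  by rewrite mul_row_col dataE addrAC subrr add0r.
split=> [[K [P [P0 stab]]]|[K [P [beta [beta0 P0 lmi]]]]].
  have PT : P^T = P by case: P0; rewrite subr0.
  have [|alpha [beta [alpha0 beta0 ineq]]] :=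
    data_S_lemma delta Q Xdot (col_mx X U) (col_mx P (K *m P)) _
      delta_gt0 N_gt0 QT As_cons.
    move=> Z; rewrite -[Z]hsubmxK => Zcons.
    by apply/(closed_loop_ltP _ _ _ _ PT)/stab/(Sigma_deltaP _ _ _ _ _ _ _ QT).
  have c0 : 0 < (2 * alpha)^-1 by rewrite invr_gt0 mulr_gt0.
  exists K, ((2 * alpha)^-1 *: P), (beta / alpha).
  have cPT : ((2 * alpha)^-1 *: P)^T = (2 * alpha)^-1 *: P.
    by rewrite linearZ /= PT.
  split; first exact: divr_gt0.
    case: P0; rewrite /loewner_lt !subr0 => _ Ppos; split=> // v /Ppos.
    by rewrite !quad_formE -scalemxAl dotZr => ?; exact: mulr_gt0.
  apply/(lmi_leP _ _ _ _ _ _ _ _ QT cPT) => v z.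
  rewrite -scalemxAr -scale_col_mx -scalemxAl dotZr.
  have := ineq v z; set q := dot v (Q *m v) - _; set f := dot z _.
  rewrite -(ler_pM2l (x := alpha^-1)) ?invr_gt0// => h.
  have -> : 2 * ((2 * alpha)^-1 * f) = alpha^-1 * f.
    by field; rewrite gt_eqF.
  rewrite -mulrN; apply: le_trans h.
  rewrite mulrDr !mulrA mulVf ?gt_eqF// mul1r.
  by rewrite (mulrC beta).
exists K, P; split=> // A B ABcons.
have PT : P^T = P by case: P0; rewrite subr0.
apply/(closed_loop_ltP _ _ _ _ PT) => v v0.
move/(Sigma_deltaP _ _ _ _ _ _ _ QT)/(_ v): ABcons.
move/(lmi_leP _ _ _ _ _ _ _ _ QT PT)/(_ v ((row_mx A B)^T *m v)): lmi.
rewrite linearB /= mulmxBl trmx_mul -(mulmxA _ (row_mx A B)^T).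
rewrite (dot_mulmxl (row_mx A B)^T) trmxK.
rewrite (mulmxA (row_mx A B)).
have : 0 < beta * dot v v by rewrite mulr_gt0// dot_gt0.
by lra.
Qed.
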